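(* For every integer $d\ge 1$ there exists a constant $c(d)>0$, depending only on $d$, such that the following holds. Let $n\ge 1$, let $X,X_1,\dots,X_n$ be independent identically distributed real-valued random variables, let $a=(a_1,\dots,a_n)$ with $a_k\in\mathbf{R}^d$, let $F_a$ be the distribution of $S_a=\sum_{k=1}^n X_k a_k$, and let $G$ be the distribution of the symmetrized random variable $\widetilde X$ (the difference of two independent copies of $X$). Let $V$ be an arbitrary Borel measure on $\mathbf{R}$ such that $\lambda=V\{\mathbf{R}\}>0$ and $V\le G$, that is, $V\{B\}\le G\{B\}$ for every Borel set $B\subset\mathbf{R}$. Then, for any $\tau>0$, $$Q(F_a,\tau)\le c(d)\int_{z\in\mathbf{R}}Q\big(H_1^{\lambda},\tau|z|^{-1}\big)\,W\{dz\},$$ where $W=\lambda^{-1}V$ and $H_1^{\lambda}$ is the infinitely divisible distribution on $\mathbf{R}^d$ with characteristic function $$t\mapsto\exp\Big(-\frac{\lambda}{2}\sum_{k=1}^{n}\big(1-\cos\langle t,a_k\rangle\big)\Big),\quad t\in\mathbf{R}^d.$$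
   Context: The concentration function of a random vector $Y$ in $\mathbf{R}^d$ with distribution $F=\mathcal{L}(Y)$ is $Q(F,\lambda)=\sup_{x\in\mathbf{R}^d}\mathbf{P}(Y\in x+\lambda B)$ for $0\le\lambda\le\infty$, where $B=\{x\in\mathbf{R}^d:\|x\|\le 1/2\}$ and $\|\cdot\|$ is the Euclidean norm; in particular $Q(F,\infty)=1$. For $z=0$ and $\tau>0$, $\tau|z|^{-1}$ is understood as $\infty$. $\langle\cdot,\cdot\rangle$ is the scalar product in $\mathbf{R}^d$. For an infinitely divisible distribution $F$ with characteristic function $\widehat F$ and $\lambda\ge 0$, $F^{\lambda}$ denotes the infinitely divisible distribution with characteristic function $\widehat F^{\lambda}(t)$; $H_1$ is the symmetric infinitely divisible distribution with characteristic function $\exp\big(-\frac12\sum_{k=1}^n(1-\cos\langle t,a_k\rangle)\big)$. *)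

(* Defs.v *)
From HB Require Import structures.
From mathcomp Require Import all_boot all_order all_algebra.
From mathcomp Require Import complex.
From mathcomp Require Import all_classical all_reals all_analysis.

Set Implicit Arguments.
Unset Strict Implicit.
Unset Printing Implicit Defensive.

Import Order.TTheory GRing.Theory Num.Theory.
Import numFieldNormedType.Exports.

Local Open Scope classical_set_scope.
Local Open Scope ring_scope.

(* 'rV[R]_d equipped with its Borel sigma-algebra; the topology of 'rV[R]_d is
   the product topology, i.e., the one of the Euclidean norm. *)
Definition borel_rV (R : realType) (d : nat) :=
  g_sigma_algebraType (@open 'rV[R]_d).

Definition dot (R : realType) (d : nat) (x y : 'rV[R]_d) : R :=
  \sum_(i < d) x 0 i * y 0 i.

(* The norm `|x| of 'rV[R]_d is the sup norm, hence this definition. *)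
Definition enorm (R : realType) (d : nat) (x : 'rV[R]_d) : R :=
  Num.sqrt (dot x x).

Definition half_ball (R : realType) (d : nat) : set 'rV[R]_d :=
  [set b | enorm b <= 2^-1].

(* x + l B with B := half_ball; the whole space for l = +oo.  Only used for
   0 <= l, so that the value at -oo is irrelevant. *)
Definition dilated_ball (R : realType) (d : nat) (x : 'rV[R]_d) (l : \bar R) :
    set 'rV[R]_d :=
  if l is r%:E then [set x + r *: b | b in @half_ball R d] else setT.

Definition concentration (R : realType) (d : nat)
    (F : set (borel_rV R d) -> \bar R) (l : \bar R) : \bar R :=
  ereal_sup [set F (dilated_ball x l) | x in [set: 'rV[R]_d]].

(* The expectation of exp(i <t, y>), through Euler's formula. *)
Definition charfun (R : realType) (d : nat) (F : probability (borel_rV R d) R)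
    (t : 'rV[R]_d) : R[i] :=
  ((\int[F]_y cos (dot t y)) +i* (\int[F]_y sin (dot t y)))%C.

Definition mutually_independent (R : realType) (dT : measure_display)
    (T : measurableType dT) (P : probability T R) (I : finType)
    (X : I -> {RV P >-> R}) : Prop :=
  forall (J : {set I}) (A : I -> set R), (forall i, measurable (A i)) ->
    (P (\bigcap_(i in [set` J]) (X i @^-1` A i)) =
      \prod_(i in J) P (X i @^-1` A i))%E.

(* The laws are compared on Borel sets only: distribution is defined on all
   sets, but its values on non-measurable ones are meaningless. *)
Definition identically_distributed (R : realType) (dT : measure_display)
    (T : measurableType dT) (P : probability T R) (I : Type)
    (X : I -> {RV P >-> R}) : Prop :=
  forall (i j : I) (A : set R), measurable A ->
    distribution P (X i) A = distribution P (X j) A.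

(* The coordinates of the product space P \x P provide the two independent
   copies of X. *)
Definition symmetrized_distribution (R : realType) (dT : measure_display)
    (T : measurableType dT) (P : probability T R) (X : {RV P >-> R}) :
    set R -> \bar R :=
  pushforward (P \x P)%E (fun w : T * T => X w.1 - X w.2).

Definition weighted_sum_distribution (R : realType) (d n : nat)
    (dT : measure_display) (T : measurableType dT) (P : probability T R)
    (X : 'I_n -> {RV P >-> R}) (a : 'I_n -> 'rV[R]_d) :
    set (borel_rV R d) -> \bar R :=
  pushforward P (fun w => (\sum_(k < n) X k w *: a k) : borel_rV R d).

(* Meaningful for finite V. *)
Definition total_mass (R : realType) (V : {measure set R -> \bar R}) :
    {nonneg R} :=
  NngNum (fine_ge0 (measure_ge0 V setT)).

Definition normalized (R : realType) (V : {measure set R -> \bar R}) :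
    {measure set R -> \bar R} :=
  mscale (((total_mass V)%:num^-1)%:nng : {nonneg R}) V.

(* tau / |z|, with value +oo at z = 0. *)
Definition div_norm (R : realType) (tau z : R) : \bar R :=
  if z == 0 then +oo%E else (tau / `|z|)%:E.

(* Main.v *)
Require Import Defs.
From HB Require Import structures.
From mathcomp Require Import all_boot all_order all_algebra.
From mathcomp Require Import complex.
From mathcomp Require Import all_classical all_reals all_analysis.
From mathcomp Require Import measurable_realfun ring lra.

(** The inequality compares two concentration functions by passing through
characteristic functions twice, and both passages use one smoothing kernel.
Let t be a random vector whose d coordinates are independent and each
distributed as the difference of two uniform variables on [0, 1].  Its
characteristic function is the product k(u) of the tri_char (u_i), where
tri_char y = 2 (1 - cos y) / y^2; it is nonnegative, bounded below on the unit
cube and integrable at infinity, so that it serves as a smooth substitute for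
the indicator function of a ball.  As t is a genuine random vector, k(u) is the
average of cos <t, u>, and Fubini replaces Fourier inversion.

From balls to characteristic functions.  The indicator function of x + tau B is
at most cos(1)^(-2d) k((y - x) / tau) (ball_le_tri_char_vec), so
P(S_a in x + tau B) is at most a constant times the mean over t of
E cos(<t, S_a - x> / tau), hence of |E exp(i <t, S_a> / tau)|.

Comparison of the characteristic functions (charsq_wsum_le_mixture).  By
independence, |E exp(i <t, S_a>)|^2 is the product over k of the numbers psi_k =
E cos(<t, a_k> X~), where X~ has the law G, and psi_k <= exp(psi_k - 1).  The
quantity 1 - psi_k is the G-integral of the nonnegative function
1 - cos(<t, a_k> z), so it only decreases when G is replaced by V.  Jensen's
inequality for exp and the probability measure W = V / lambda then gives
|E exp(i <t, S_a>)| <= int H^(z t) W(dz), where H^ is the characteristic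
function of H_1^lambda.

From characteristic functions back to balls.  For fixed z, Fubini shows that the
mean over t of H^(z t / tau) is the H-integral of k(z y / tau).  As k is
dominated by a convergent sum of weights over a lattice of cells of side 1/d,
and the points y with z y / tau in one cell lie in a ball of
diameter tau / |z|, this integral is at most a constant times
Q(H_1^lambda, tau / |z|) (small_ball_tri_char_vec). *)

Set Implicit Arguments.
Unset Strict Implicit.
Unset Printing Implicit Defensive.

Import Order.TTheory GRing.Theory Num.Theory.
Import numFieldNormedType.Exports.

Local Open Scope classical_set_scope.
Local Open Scope ring_scope.

(** * Integrals of bounded functions *)

Lemma measurable_cosine (R : realType) : measurable_fun [set: R] (@cos R).
Proof. by apply: continuous_measurable_fun; exact: continuous_cos. Qed.

Lemma measurable_sine (R : realType) : measurable_fun [set: R] (@sin R).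
Proof. by apply: continuous_measurable_fun; exact: continuous_sin. Qed.

Section bounded_integration.
Context d (T : measurableType d) (R : realType).

Lemma bounded_integrable (mu : {measure set T -> \bar R}) (M : R)
    (f : T -> R) : (mu setT < +oo)%E ->
    measurable_fun setT f -> (forall x, `|f x| <= M) ->
  mu.-integrable setT (EFin \o f).
Proof.
move=> muoo mf bf; apply: measurable_bounded_integrable => //.
by exists M; split; rewrite ?num_real// => y My x _; exact: (le_trans (bf x) (ltW My)).
Qed.

Lemma bounded_integrableP (P : probability T R) (M : R)
    (f : T -> R) : measurable_fun setT f -> (forall x, `|f x| <= M) ->
  P.-integrable setT (EFin \o f).
Proof.
by apply: bounded_integrable; rewrite [ltLHS]probability_setT ltry.
Qed.

Lemma integrable_cos (P : probability T R) (f : T -> R) :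
  measurable_fun setT f -> P.-integrable setT (EFin \o (cos \o f)).
Proof.
move=> mf; apply: (@bounded_integrableP _ 1) => [|x]; last exact: cos_max.
by apply: measurableT_comp => //; exact: measurable_cosine.
Qed.

Lemma integrable_sin (P : probability T R) (f : T -> R) :
  measurable_fun setT f -> P.-integrable setT (EFin \o (sin \o f)).
Proof.
move=> mf; apply: (@bounded_integrableP _ 1) => [|x]; last exact: sin_max.
by apply: measurableT_comp => //; exact: measurable_sine.
Qed.

Lemma EFin_Rintegral (mu : {measure set T -> \bar R}) (f : T -> R) :
  mu.-integrable setT (EFin \o f) ->
  ((\int[mu]_x f x)%:E = \int[mu]_x (f x)%:E)%E.
Proof. by move=> If; rewrite fineK//; exact: integrable_fin_num. Qed.

Lemma Rintegral_cst1 (P : probability T R) (r : R) : \int[P]_x r = r.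
Proof.
rewrite Rintegral_cst; [|exact: measurableT].
by rewrite [X in fine X](_ : _ = 1%E) ?mulr1//; exact: probability_setT.
Qed.

Lemma RintegralDZ (mu : {measure set T -> \bar R}) (a b : R) (f g : T -> R) :
  mu.-integrable setT (EFin \o f) -> mu.-integrable setT (EFin \o g) ->
  \int[mu]_x (a * f x + b * g x) = a * \int[mu]_x f x + b * \int[mu]_x g x.
Proof.
move=> If Ig; rewrite RintegralD//; first by rewrite !RintegralZl.
  exact: (@integrableZl _ _ _ _ _ _ a (EFin \o f)).
exact: (@integrableZl _ _ _ _ _ _ b (EFin \o g)).
Qed.

End bounded_integration.

Section bounded_fubini.
Context d1 (T1 : measurableType d1) d2 (T2 : measurableType d2) (R : realType).
Variables (P1 : probability T1 R) (P2 : probability T2 R).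
Variables (f : T1 * T2 -> R) (M : R).
Hypotheses (mf : measurable_fun setT f) (bf : forall x, `|f x| <= M).

Let If : (P1 \x P2)%E.-integrable setT (EFin \o f).
Proof.
have := @bounded_integrableP _ _ _ [the probability _ _ of (P1 \x P2)%E] M f mf bf.
exact.
Qed.

Lemma Rintegral_prod1 :
  \int[P1]_x \int[P2]_y f (x, y) = \int[(P1 \x P2)%E]_z f z.
Proof.
rewrite [RHS]/Rintegral -integral12_prod_meas1//; congr fine.
apply: eq_integral => x _; rewrite EFin_Rintegral//.
by apply: (@bounded_integrableP _ _ _ _ M) => //; exact: measurableT_comp.
Qed.

Lemma Rintegral_prod2 :
  \int[P2]_y \int[P1]_x f (x, y) = \int[(P1 \x P2)%E]_z f z.
Proof.
rewrite [RHS]/Rintegral -integral21_prod_meas1//; congr fine.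
apply: eq_integral => x _; rewrite EFin_Rintegral//.
by apply: (@bounded_integrableP _ _ _ _ M) => //; exact: measurableT_comp.
Qed.

Lemma integrable_Rintegral1 :
  P1.-integrable setT (EFin \o (fun x => \int[P2]_y f (x, y))).
Proof.
apply: eq_integrable (integrable_fubini_F If) => // x _; rewrite /= EFin_Rintegral//.
by apply: (@bounded_integrableP _ _ _ _ M) => //; exact: measurableT_comp.
Qed.

Lemma Rintegral_Fubini : \int[P1]_x \int[P2]_y f (x, y) =
  \int[P2]_y \int[P1]_x f (x, y).
Proof. by rewrite Rintegral_prod1 Rintegral_prod2. Qed.

End bounded_fubini.

Lemma integrable_Rintegral2 d1 (T1 : measurableType d1) d2
    (T2 : measurableType d2) (R : realType) (P1 : probability T1 R)
    (P2 : probability T2 R) (f : T1 * T2 -> R) (M : R) :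
  measurable_fun setT f -> (forall x, `|f x| <= M) ->
  P2.-integrable setT (EFin \o (fun y => \int[P1]_x f (x, y))).
Proof.
move=> mf bf.
apply: (@integrable_Rintegral1 _ _ _ _ _ P2 P1 (fun z => f (z.2, z.1)) M) => //.
by apply: measurableT_comp => //; exact: measurable_fun_pair.
Qed.

(** * Characteristic functions, through cosines and sines *)

Section trigonometric_addition.
Context d1 (T1 : measurableType d1) d2 (T2 : measurableType d2) (R : realType).
Variables (P1 : probability T1 R) (P2 : probability T2 R).
Variables (f : T1 -> R) (g : T2 -> R).
Hypotheses (mf : measurable_fun setT f) (mg : measurable_fun setT g).

Let mfg : measurable_fun setT (fun z : T1 * T2 => f z.1 + g z.2).
Proof. by apply: measurable_funD; apply: measurableT_comp. Qed.

Let IcP1 := integrable_cos P1 mf.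
Let IsP1 := integrable_sin P1 mf.
Let IcP2 := integrable_cos P2 mg.
Let IsP2 := integrable_sin P2 mg.

Lemma Rintegral_cosD : \int[(P1 \x P2)%E]_z cos (f z.1 + g z.2) =
  (\int[P1]_x cos (f x)) * (\int[P2]_y cos (g y)) -
  (\int[P1]_x sin (f x)) * (\int[P2]_y sin (g y)).
Proof.
rewrite -(@Rintegral_prod1 _ _ _ _ _ _ _ _ 1)/=; last 2 first.
- exact: measurableT_comp (@measurable_cosine R) mfg.
- by move=> z; exact: cos_max.
transitivity (\int[P1]_x ((\int[P2]_y cos (g y)) * cos (f x) +
    (- \int[P2]_y sin (g y)) * sin (f x))); last by rewrite RintegralDZ//; ring.
apply: eq_Rintegral => x _.
transitivity (\int[P2]_y (cos (f x) * cos (g y) + (- sin (f x)) * sin (g y))).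
  by apply: eq_Rintegral => y _; rewrite cosD mulNr.
by rewrite RintegralDZ//; ring.
Qed.

Lemma Rintegral_sinD : \int[(P1 \x P2)%E]_z sin (f z.1 + g z.2) =
  (\int[P1]_x sin (f x)) * (\int[P2]_y cos (g y)) +
  (\int[P1]_x cos (f x)) * (\int[P2]_y sin (g y)).
Proof.
rewrite -(@Rintegral_prod1 _ _ _ _ _ _ _ _ 1)/=; last 2 first.
- exact: measurableT_comp (@measurable_sine R) mfg.
- by move=> z; exact: sin_max.
transitivity (\int[P1]_x ((\int[P2]_y cos (g y)) * sin (f x) +
    (\int[P2]_y sin (g y)) * cos (f x))); last by rewrite RintegralDZ//; ring.
apply: eq_Rintegral => x _.
transitivity (\int[P2]_y (sin (f x) * cos (g y) + cos (f x) * sin (g y))).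
  by apply: eq_Rintegral => y _; rewrite sinD.
by rewrite RintegralDZ//; ring.
Qed.

End trigonometric_addition.

Section charsq.
Context d (T : measurableType d) (R : realType).

(** The squared modulus of the characteristic function at 1 of the law of Z. *)
Definition charsq (mu : {measure set T -> \bar R}) (Z : T -> R) : R :=
  (\int[mu]_x cos (Z x)) ^+ 2 + (\int[mu]_x sin (Z x)) ^+ 2.

Variable P : probability T R.

(** The left-hand side is the real part of exp(- i a) E exp(i Z): a rotation of
the plane does not change the modulus. *)
Lemma Rintegral_cosB_le (Z : T -> R) (a : R) : measurable_fun setT Z ->
  \int[P]_x cos (Z x - a) <= Num.sqrt (charsq P Z).
Proof.
move=> mZ.
have -> : \int[P]_x cos (Z x - a) = \int[P]_x (cos a * cos (Z x) + sin a * sin (Z x)).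
  by apply: eq_Rintegral => x _; rewrite cosB; ring.
rewrite RintegralDZ; [|exact: integrable_cos|exact: integrable_sin].
rewrite /charsq; set A := \int[P]_x cos _; set B := \int[P]_x sin _.
apply: (le_trans (ler_norm _)); rewrite -sqrtr_sqr ler_wsqrtr//.
have := cos2Dsin2 a; set c := cos a; set s := sin a => cs.
rewrite -subr_ge0.
have -> : A ^+ 2 + B ^+ 2 - (c * A + s * B) ^+ 2 =
  (A ^+ 2 + B ^+ 2) * (1 - (c ^+ 2 + s ^+ 2)) + (A * s - B * c) ^+ 2 by ring.
by rewrite cs subrr mulr0 add0r sqr_ge0.
Qed.

(** Used below for the second of two independent copies of Z, which enters with
a minus sign. *)
Let Rintegral_oppr (Z : T -> R) : measurable_fun setT Z ->
  (\int[P]_x cos (- Z x) = \int[P]_x cos (Z x)) *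
  (\int[P]_x sin (- Z x) = - \int[P]_x sin (Z x)).
Proof.
move=> mZ; split; first by apply: eq_Rintegral => x _; rewrite cosN.
rewrite -mulN1r -RintegralZl//; last exact: integrable_sin.
by apply: eq_Rintegral => x _; rewrite sinN mulN1r.
Qed.

(** The squared modulus of a characteristic function is the characteristic
function of the symmetrized law. *)
Lemma charsqE (Z : T -> R) : measurable_fun setT Z ->
  charsq P Z = \int[(P \x P)%E]_w cos (Z w.1 - Z w.2).
Proof.
move=> mZ; have mNZ : measurable_fun setT (fun x => - Z x).
  exact: measurableT_comp.
by rewrite (Rintegral_cosD P P mZ mNZ) !Rintegral_oppr// /charsq; ring.
Qed.

(** The symmetrized law is invariant under sign change. *)
Lemma Rintegral_sinB_eq0 (Z : T -> R) : measurable_fun setT Z ->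
  \int[(P \x P)%E]_w sin (Z w.1 - Z w.2) = 0.
Proof.
move=> mZ; have mNZ : measurable_fun setT (fun x => - Z x).
  exact: measurableT_comp.
by rewrite (Rintegral_sinD P P mZ mNZ) !Rintegral_oppr//; ring.
Qed.

End charsq.

(** * Independence and sums *)

Section independent_pair.
Context d (T : measurableType d) (R : realType) (P : probability T R).
Local Open Scope ereal_scope.

(** Two variables that are independent of each other and, jointly on rectangles,
of an event E have a product law that is still independent of E: both sides are
finite measures in C that agree on rectangles.  The event E is what makes the
induction over the terms of a sum possible. *)
Lemma indep_pair_law (Y X : {mfun T >-> R}) (E : set T) : measurable E ->
  (forall A B, measurable A -> measurable B ->
    P (Y @^-1` A `&` X @^-1` B `&` E) = P (Y @^-1` A) * P (X @^-1` B) * P E) ->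
  forall C, measurable C -> P ((fun w => (Y w, X w)) @^-1` C `&` E) =
    (distribution P Y \x distribution P X) C * P E.
Proof.
move=> mE YXE C mC.
have PEfin : P E \is a fin_num by exact: fin_num_measure.
pose k : {nonneg R} := NngNum (fine_ge0 (measure_ge0 P E)).
have kE : k%:num%:E = P E by rewrite /= fineK.
pose m1 : {finite_measure set R -> \bar R} := mscale k (distribution P Y).
have mYX : measurable_fun setT (fun w => (Y w, X w)).
  by apply: measurable_fun_pair.
pose mr : {measure set T -> \bar R} := mrestr P mE.
pose m' : {measure set (R * R)%type -> \bar R} :=
  measure_function_pushforward__canonical__measure_function_Measure mr mYX.
have m'E A B : measurable A -> measurable B ->
    m' (A `*` B) = m1 A * distribution P X B.
  move=> mA mB.
  transitivity (P (Y @^-1` A `&` X @^-1` B `&` E)) => //.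
  by rewrite YXE// /m1/= /mscale kE muleC muleA.
transitivity ((m1 \x distribution P X) C).
  by rewrite (product_measure_unique m'E).
rewrite {1}/product_measure1 ge0_integral_mscale//; last first.
  exact: measurable_fun_xsection.
by rewrite kE muleC.
Qed.

Lemma Rintegral_indep_pair (Y X : {mfun T >-> R}) (g : R * R -> R) (M : R) :
  (forall A B, measurable A -> measurable B ->
    P (Y @^-1` A `&` X @^-1` B) = P (Y @^-1` A) * P (X @^-1` B)) ->
  measurable_fun setT g -> (forall z, `|g z| <= M)%R ->
  (\int[P]_w g (Y w, X w) =
    \int[(distribution P Y \x distribution P X)%E]_z g z)%R.
Proof.
move=> YX mg bg.
have mYX : measurable_fun setT (fun w => (Y w, X w)).
  by apply: measurable_fun_pair.
rewrite /Rintegral; congr fine.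
transitivity (\int[pushforward P (fun w => (Y w, X w))]_z (g z)%:E).
  rewrite integral_pushforward//; first exact/measurable_EFinP.
  rewrite preimage_setT.
  apply: (@bounded_integrableP _ _ _ _ M) => //; exact: measurableT_comp.
apply: eq_measure_integral => A mA _.
have := @indep_pair_law Y X setT measurableT _ A mA.
have PT : P setT = 1 by exact: probability_setT.
rewrite !setIT PT mule1; apply=> B C mB mC.
by rewrite setIT YX// mule1.
Qed.

Lemma Rintegral_distribution (X : {mfun T >-> R}) (g : R -> R) (M : R) :
  measurable_fun setT g -> (forall z, `|g z| <= M)%R ->
  (\int[distribution P X]_x g x = \int[P]_w g (X w))%R.
Proof.
move=> mg bg; rewrite /Rintegral integral_distribution//.
  exact/measurable_EFinP.
apply: (@bounded_integrableP _ _ _ _ M) => //; exact: measurableT_comp.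
Qed.

Local Open Scope ring_scope.

(** With E exp(i Y) = a + i b and E exp(i X) = c + i d, the addition formulas
give E exp(i (Y + X)) = (a + i b) (c + i d), and the modulus is
multiplicative. *)
Lemma charsq_indepD (Y X : {mfun T >-> R}) :
  (forall A B, measurable A -> measurable B ->
    P (Y @^-1` A `&` X @^-1` B) = (P (Y @^-1` A) * P (X @^-1` B))%E) ->
  charsq P (fun w => Y w + X w) = charsq P Y * charsq P X.
Proof.
move=> YX; rewrite /charsq.
have mid : measurable_fun [set: R] id by exact: measurable_id.
have mD : measurable_fun setT (fun z : R * R => z.1 + z.2).
  exact: measurable_funD.
have cE (Z : {mfun T >-> R}) :
    \int[P]_w cos (Z w) = \int[distribution P Z]_x cos (id x).
  rewrite (@Rintegral_distribution _ _ 1) => [//||x]; last exact: cos_max.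
  exact: measurable_cosine.
have sE (Z : {mfun T >-> R}) :
    \int[P]_w sin (Z w) = \int[distribution P Z]_x sin (id x).
  rewrite (@Rintegral_distribution _ _ 1) => [//||x]; last exact: sin_max.
  exact: measurable_sine.
rewrite (@Rintegral_indep_pair _ _ (fun z => cos (z.1 + z.2)) 1)//=; last 2 first.
- exact: (measurableT_comp (@measurable_cosine R)).
- by move=> ?; exact: cos_max.
rewrite (@Rintegral_indep_pair _ _ (fun z => sin (z.1 + z.2)) 1)//=; last 2 first.
- exact: (measurableT_comp (@measurable_sine R)).
- by move=> ?; exact: sin_max.
rewrite (Rintegral_cosD _ _ mid mid) (Rintegral_sinD _ _ mid mid) !cE !sE.
ring.
Qed.

End independent_pair.

Section independent_sum.
Context d (T : measurableType d) (R : realType) (P : probability T R).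
Context (I : finType) (X : I -> {RV P >-> R}) (s : I -> R).
Hypothesis Xindep : mutually_independent X.

Local Notation wsum r := (fun w => \sum_(k <- r) s k * X k w).

Lemma measurable_wsum (r : seq I) : measurable_fun setT (wsum r).
Proof. by apply: measurable_sum => k; exact: measurable_funM. Qed.

(** A partial sum is independent of the remaining variables.  Induction on r:
the new term X k is first treated as one of the remaining variables, which
separates X k from the sum over r; then the pair of both has a product law that
is independent of the events on J, and the sum over k :: r is a function of
that pair. *)
Lemma wsum_indep (r : seq I) (J : {set I}) (B : I -> set R) (A : set R) :
  uniq r -> {in J, forall i, i \notin r} -> (forall i, measurable (B i)) ->
  measurable A ->
  (P (wsum r @^-1` A `&` \bigcap_(i in [set` J]) (X i @^-1` B i)) =
   P (wsum r @^-1` A) * P (\bigcap_(i in [set` J]) (X i @^-1` B i)))%E.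
Proof.
have PT : P setT = 1%E by exact: probability_setT.
elim: r J B A => [|k r IH] J B A /=.
  move=> _ _ _ _.
  have [A0|A0] := pselect (A 0).
    rewrite (_ : _ @^-1` A = setT) ?setTI ?PT ?mul1e//.
    by apply/seteqP; split => // w _ /=; rewrite big_nil.
  rewrite (_ : _ @^-1` A = set0) ?set0I ?measure0 ?mul0e//.
  by apply/seteqP; split => // w /=; rewrite big_nil.
move=> /andP[kr ur] Jkr mB mA.
pose Yr : {mfun T >-> R} :=
  HB.pack (wsum r) (isMeasurableFun.Build _ _ _ _ (wsum r) (@measurable_wsum r)).
pose C : set (R * R) := [set z | A (s k * z.2 + z.1)].
have mC : measurable C.
  have mf : measurable_fun setT (fun z : R * R => s k * z.2 + z.1).
    by apply: measurable_funD => //; apply: measurable_funM.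
  by have := mf measurableT A mA; rewrite setTI.
have pre : wsum (k :: r) @^-1` A = (fun w => (Yr w, X k w)) @^-1` C.
  by apply/seteqP; split => w /=; rewrite /C/= big_cons.
have law (J' : {set I}) : {in J', forall i, i \notin k :: r} ->
    (P (wsum (k :: r) @^-1` A `&` \bigcap_(i in [set` J']) (X i @^-1` B i)) =
    (distribution P Yr \x distribution P (X k)) C *
      P (\bigcap_(i in [set` J']) (X i @^-1` B i)))%E.
  move=> Jkr'; set E := \bigcap_(i in [set` J']) (X i @^-1` B i).
  have mE : measurable E.
    by apply: fin_bigcap_measurable => // i _; exact: measurable_funPTI.
  have kJ : k \notin J' by apply/negP => /Jkr'; rewrite inE eqxx.
  have Jr : {in J', forall i, i \notin r}.
    by move=> i /Jkr'; rewrite inE negb_or => /andP[].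
  rewrite pre; apply: indep_pair_law => // A' Bk mA' mBk; rewrite -setIA.
  (* the events on X k and on J' form one event on k |: J' *)
  pose B' i := if i == k then Bk else B i.
  have mB' i : measurable (B' i) by rewrite /B'; case: ifP.
  have EB' : E = \bigcap_(i in [set` J']) (X i @^-1` B' i).
    apply: eq_bigcapr => i iJ; rewrite /B'; case: eqP => // ik.
    by move: iJ; rewrite /= ik (negbTE kJ).
  have UE : X k @^-1` Bk `&` E =
      \bigcap_(i in [set` (k |: J')%SET]) (X i @^-1` B' i).
    rewrite EB'; apply/seteqP; split => w /=.
      move=> [wk wE] i /=; rewrite !inE => /orP[/eqP ->|iJ].
        by rewrite /B' eqxx.
      exact: wE.
    move=> wE; split.
      by have := wE k; rewrite /= /B' eqxx; apply; rewrite !inE eqxx.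
    by move=> i /= iJ; apply: wE; rewrite /= !inE iJ orbT.
  rewrite UE IH//; last first.
    by move=> i; rewrite !inE => /orP[/eqP ->|/Jr].
  by rewrite EB' !Xindep// big_setU1//= {1}/B' eqxx muleA.
(* the case of no event identifies the factor of law with the probability of
   the sum *)
rewrite law//; congr (_ * _)%E.
have := law finset.set0; rewrite (_ : \bigcap_(i in [set` finset.set0]) _ = setT).
  rewrite setIT PT mule1 => -> // i; by rewrite inE.
by rewrite -subTset => w _ i /=; rewrite inE.
Qed.

Lemma charsq_wsum (r : seq I) : uniq r ->
  charsq P (wsum r) = \prod_(k <- r) charsq P (fun w => s k * X k w).
Proof.
elim: r => [_|k r IH /= /andP[kr ur]].
  rewrite big_nil /charsq.
  under eq_Rintegral do rewrite big_nil cos0.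
  rewrite Rintegral_cst1.
  under eq_Rintegral do rewrite big_nil sin0.
  by rewrite Rintegral_cst1 expr1n expr0n addr0.
rewrite big_cons -IH//.
pose Yr : {mfun T >-> R} :=
  HB.pack (wsum r) (isMeasurableFun.Build _ _ _ _ (wsum r) (@measurable_wsum r)).
have msX : measurable_fun setT (fun w => s k * X k w).
  exact: measurable_funM.
pose sX : {mfun T >-> R} :=
  HB.pack (fun w => s k * X k w) (isMeasurableFun.Build _ _ _ _ _ msX).
rewrite mulrC -(@charsq_indepD _ _ _ P Yr sX).
  rewrite /charsq; congr (_ ^+ 2 + _ ^+ 2);
    by apply: eq_Rintegral => w _ /=; rewrite big_cons addrC.
move=> A B mA mB.
have msk : measurable_fun [set: R] (fun x => s k * x) by exact: measurable_funM.
have mB' : measurable ((fun x => s k * x) @^-1` B).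
  by have := msk measurableT B mB; rewrite setTI.
have := @wsum_indep r [set k]%SET (fun=> (fun x => s k * x) @^-1` B) A ur.
rewrite (_ : \bigcap_(i in _) _ = sX @^-1` B); last first.
  apply/seteqP; split => w /=; first by apply; exact/set1P.
  by move=> Bw i /= /set1P ->.
by apply=> // i; rewrite inE => /eqP ->.
Qed.

End independent_sum.

(** * Bound of the characteristic function of a sum by a mixture *)

Section jensen.
Context d (T : measurableType d) (R : realType).

(** Jensen's inequality: integrate the inequality between expR and its tangent
at the mean m of g, expR m * (1 + g x - m) <= expR (g x). *)
Lemma expR_Rintegral_le (mu : {measure set T -> \bar R}) (M : R) (g : T -> R) :
  mu setT = 1%E -> measurable_fun setT g -> (forall x, `|g x| <= M) ->
  expR (\int[mu]_x g x) <= \int[mu]_x expR (g x).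
Proof.
move=> mu1 mg bg; set m := \int[mu]_x g x.
have muoo : (mu setT < +oo)%E by rewrite mu1 ltry.
have Ig : mu.-integrable setT (EFin \o g) by exact: bounded_integrable bg.
have I1 : mu.-integrable setT (EFin \o (fun=> 1 : R)).
  by apply: (@bounded_integrable _ _ _ _ 1) => // x; rewrite normr1.
have Ie : mu.-integrable setT (EFin \o (fun x => expR (g x))).
  apply: (@bounded_integrable _ _ _ _ (expR M)) => //.
    exact: (measurableT_comp (@measurable_expR R)).
  move=> x; rewrite ger0_norm ?expR_ge0// ler_expR.
  exact: le_trans (ler_norm _) (bg x).
have IL : mu.-integrable setT
    (EFin \o (fun x => expR m * (1 - m) * 1 + expR m * g x)).
  rewrite (_ : EFin \o _ = (fun x => (expR m * (1 - m))%:E * (1%:E : \bar R) +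
    (expR m)%:E * (g x)%:E)%E)//.
  by apply: integrableD => //; exact: integrableZl.
have -> : expR m = \int[mu]_x (expR m * (1 - m) * 1 + expR m * g x).
  rewrite RintegralDZ// Rintegral_cst// mu1/= -/m; ring.
apply: le_Rintegral => // x _.
have -> : expR (g x) = expR m * expR (g x - m) by rewrite -expRD subrKC.
have := expR_ge1Dx (g x - m); have := expR_gt0 m; nra.
Qed.

End jensen.

Section symmetrization.
Context d (T : measurableType d) (R : realType) (P : probability T R).
Variables (X : {RV P >-> R}) (V : {measure set R -> \bar R}).
Hypothesis VG : forall B : set R, measurable B ->
  (V B <= symmetrized_distribution X B)%E.

Let mdiff : measurable_fun setT (fun w : T * T => X w.1 - X w.2).
Proof. by apply: measurable_funB; apply: measurableT_comp. Qed.

Let G : {measure set R -> \bar R} :=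
  measure_function_pushforward__canonical__measure_function_Measure
    (P \x P)%E mdiff.

Lemma symmetrized_minorant_le1 : (V setT <= 1)%E.
Proof.
apply: le_trans (VG measurableT) _.
by rewrite /symmetrized_distribution /pushforward preimage_setT probability_setT.
Qed.

(** This is psi <= exp(psi - 1) with 1 - psi the integral of the nonnegative
function 1 - cos (s z) against the symmetrized law, which dominates V. *)
Lemma charsq_symmetrized_le (s : R) :
  charsq P (fun w => s * X w) <= expR (- \int[V]_z (1 - cos (s * z))).
Proof.
set psi := charsq _ _; have psiE : 1 + (psi - 1) = psi by ring.
rewrite -psiE; apply: le_trans (expR_ge1Dx _) _; rewrite ler_expR -opprB lerN2.
have Voo : (V setT < +oo)%E.
  by rewrite (le_lt_trans symmetrized_minorant_le1)// ltry.
have m1c : measurable_fun [set: R] (fun z => 1 - cos (s * z)).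
  apply: measurable_funB => //; apply: measurableT_comp => //.
    exact: measurable_cosine.
have ge0_1c (x : R) : 0 <= 1 - cos x by rewrite subr_ge0 cos_le1.
have IV : V.-integrable setT (EFin \o (fun z => 1 - cos (s * z))).
  apply: (@bounded_integrable _ _ _ _ 2) => // z.
  by rewrite ger0_norm// lerBlDr -lerBlDl; apply: le_trans (cos_geN1 _); lra.
have Ic : (P \x P)%E.-integrable setT
    (EFin \o (fun w : T * T => cos (s * X w.1 - s * X w.2))).
  apply: (@integrable_cos _ _ _ (P \x P)%E (fun w : T * T => s * X w.1 - s * X w.2)).
  by apply: measurable_funB; apply: measurable_funM => //; apply: measurableT_comp.
have I1 : (P \x P)%E.-integrable setT (EFin \o (fun=> 1 : R)).
  by apply: (@bounded_integrableP _ _ _ (P \x P)%E 1) => // x; rewrite normr1.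
have -> : 1 - psi = \int[(P \x P)%E]_w (1 - cos (s * X w.1 - s * X w.2)).
  rewrite RintegralB// Rintegral_cst1 /psi charsqE//.
  exact: measurable_funM.
rewrite -lee_fin EFin_Rintegral//.
have I1c : (P \x P)%E.-integrable setT
    (EFin \o (fun w : T * T => 1 - cos (s * X w.1 - s * X w.2))).
  by have := integrableB measurableT I1 Ic.
rewrite EFin_Rintegral//.
apply: (@le_trans _ _ (\int[G]_z (1 - cos (s * z))%:E)%E).
  by apply: ge0_le_measure_integral => //; exact/measurable_EFinP.
rewrite ge0_integral_pushforward//.
- rewrite preimage_setT le_eqVlt; apply/orP; left; apply/eqP.
  by apply: eq_integral => w _ /=; rewrite mulrBr.
- exact/measurable_EFinP.
Qed.

End symmetrization.

Section mixture_bound.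
Context d (T : measurableType d) (R : realType) (P : probability T R).
Variables (X : {RV P >-> R}) (V : {measure set R -> \bar R}).
Hypothesis VG : forall B : set R, measurable B ->
  (V B <= symmetrized_distribution X B)%E.
Hypothesis V_gt0 : (0 < V setT)%E.

Lemma total_mass_gt0 : 0 < (total_mass V)%:num.
Proof.
by rewrite /= fine_gt0// V_gt0/= (le_lt_trans (symmetrized_minorant_le1 VG))// ltry.
Qed.

Lemma normalized_setT : normalized V setT = 1%E.
Proof.
have V0 := total_mass_gt0.
have Vfin : V setT \is a fin_num.
  by rewrite ge0_fin_numE// (le_lt_trans (symmetrized_minorant_le1 VG))// ltry.
transitivity (((total_mass V)%:num^-1)%:E * V setT)%E => //.
by rewrite -[V setT]fineK// -EFinM mulVf// gt_eqF.
Qed.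

Context (I : finType) (Y : I -> {RV P >-> R}) (s : I -> R).
Hypothesis Yindep : mutually_independent Y.
Hypothesis YX : forall k (A : set R), measurable A ->
  distribution P (Y k) A = distribution P X A.

Lemma charsq_identical k (r : R) :
  charsq P (fun w => r * Y k w) = charsq P (fun w => r * X w).
Proof.
have mr : measurable_fun setT (fun x : R => r * x) by exact: measurable_funM.
have mc := measurableT_comp (@measurable_cosine R) mr.
have ms := measurableT_comp (@measurable_sine R) mr.
rewrite /charsq; congr (_ ^+ 2 + _ ^+ 2).
  rewrite -(@Rintegral_distribution _ _ _ P (Y k) _ 1 mc) => [|z]; last exact: cos_max.
  rewrite -(@Rintegral_distribution _ _ _ P X _ 1 mc) => [|z]; last exact: cos_max.
  by congr fine; apply: eq_measure_integral => A mA _; exact: YX.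
rewrite -(@Rintegral_distribution _ _ _ P (Y k) _ 1 ms) => [|z]; last exact: sin_max.
rewrite -(@Rintegral_distribution _ _ _ P X _ 1 ms) => [|z]; last exact: sin_max.
by congr fine; apply: eq_measure_integral => A mA _; exact: YX.
Qed.

(** The product of the bounds of charsq_symmetrized_le is the exponential of
an integral against V; as V is total_mass V times its normalization, that
integral is a mean, to which Jensen's inequality applies.  The square root
accounts for the factor 2^-1 in the exponent. *)
Lemma charsq_wsum_le_mixture :
  Num.sqrt (charsq P (fun w => \sum_k s k * Y k w)) <=
  \int[normalized V]_z
    expR (- ((total_mass V)%:num / 2 * \sum_k (1 - cos (s k * z)))).
Proof.
set lam := (total_mass V)%:num; have lam0 : 0 < lam := total_mass_gt0.
have Voo : (V setT < +oo)%E.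
  by rewrite (le_lt_trans (symmetrized_minorant_le1 VG))// ltry.
pose f k (z : R) := 1 - cos (s k * z).
have mf k : measurable_fun setT (f k).
  apply: measurable_funB => //; apply: measurableT_comp => //.
  exact: measurable_cosine.
have f0 k z : 0 <= f k z by rewrite subr_ge0 cos_le1.
have f2 k z : f k z <= 2.
  by rewrite lerBlDr -lerBlDl; apply: le_trans (cos_geN1 _); lra.
have If k : V.-integrable setT (EFin \o f k).
  by apply: (@bounded_integrable _ _ _ _ 2) => // z; rewrite ger0_norm.
pose g z := \sum_k f k z.
have mg : measurable_fun setT g by exact: measurable_sum.
pose h z := - (lam / 2 * g z).
have mh : measurable_fun setT h.
  by apply: measurableT_comp => //; apply: measurable_funM.
have bh z : `|h z| <= lam / 2 * \sum_(k : I) 2.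
  have lam2 : 0 <= lam / 2 by rewrite divr_ge0// ltW.
  rewrite normrN normrM (ger0_norm lam2) ler_wpM2l// ger0_norm; first exact: ler_sum.
  exact: sumr_ge0.
apply: le_trans (expR_Rintegral_le normalized_setT mh bh).
have -> : \int[normalized V]_z h z = - ((\sum_k \int[V]_z f k z) / 2).
  have Woo : (normalized V setT < +oo)%E by rewrite normalized_setT ltry.
  have Vg : \int[V]_z g z = \sum_k \int[V]_z f k z.
    rewrite /Rintegral; under eq_integral do rewrite -sumEFin.
    rewrite integral_sum// -sum_fine// => k _.
    by have := integrable_fin_num measurableT (If k).
  have Wg : \int[normalized V]_z g z = lam^-1 * \int[V]_z g z.
    rewrite /Rintegral ge0_integral_mscale//; last 2 first.
    - exact/measurable_EFinP.
    - by move=> z _; rewrite lee_fin sumr_ge0.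
    rewrite fineM//; apply: integrable_fin_num => //.
    have := @integrable_sum _ _ _ V setT measurableT _ (index_enum I) xpredT
      (fun k => EFin \o f k).
    rewrite (_ : (fun x => (\sum_(i : I) (EFin \o f i) x)%E) = EFin \o g); last first.
      by apply/funext => z; rewrite /= sumEFin.
    exact.
  under eq_Rintegral do rewrite /h -mulNr.
  rewrite RintegralZl//; last first.
    apply: (@bounded_integrable _ _ _ _ (\sum_(k : I) 2)) => // z.
    by rewrite ger0_norm; [exact: ler_sum|exact: sumr_ge0].
  by rewrite Wg Vg; field; rewrite gt_eqF.
rewrite charsq_wsum ?index_enum_uniq//.
apply: (@le_trans _ _ (Num.sqrt (expR (- \sum_k \int[V]_z f k z)))).
  rewrite ler_wsqrtr// -sumrN expR_sum; apply: ler_prod => k _.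
  by rewrite charsq_identical charsq_symmetrized_le// addr_ge0 ?sqr_ge0.
rewrite [X in Num.sqrt X](_ : _ = expR (- ((\sum_k \int[V]_z f k z) / 2)) ^+ 2).
  by rewrite sqrtr_sqr ger0_norm ?expR_ge0.
by rewrite -expRM_natl; congr expR; field.
Qed.

End mixture_bound.

(** * The triangular law and its characteristic function *)

Section triangular_kernel.
Variable R : realType.

Let M := measurableTypeR R.
Let U : probability M R := uniform_prob (@ltr01 R).

(** The characteristic function at y of the difference of two independent
uniform variables on [0, 1], by charsqE; the density of the difference is a
triangle. *)
Definition tri_char (y : R) : R := charsq U (fun u : M => y * (u : R)).

Let mlin (y : R) : measurable_fun setT (fun u : M => y * (u : R)).
Proof. by have : measurable_fun setT (fun u : R => y * u) by exact: measurable_funM. Qed.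

Lemma tri_char_ge0 y : 0 <= tri_char y.
Proof. by rewrite addr_ge0 ?sqr_ge0. Qed.

Lemma tri_char_le1 y : tri_char y <= 1.
Proof.
rewrite /tri_char charsqE// -[leRHS](Rintegral_cst1 (U \x U)%E).
apply: le_Rintegral => //.
- apply: (@integrable_cos _ _ _ (U \x U)%E (fun w : M * M => y * w.1 - y * w.2)).
  by apply: measurable_funB; apply: measurable_funM.
- by apply: (@bounded_integrableP _ _ _ (U \x U)%E 1) => // x; rewrite normr1.
Qed.

Lemma tri_char0 : tri_char 0 = 1.
Proof.
rewrite /tri_char /charsq.
under eq_Rintegral do rewrite mul0r cos0.
under [X in _ + X ^+ 2]eq_Rintegral do rewrite mul0r sin0.
by rewrite !Rintegral_cst1; ring.
Qed.

(** tri_char is a partial integral, to which Tonelli applies once the integrand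
is shifted by 1 to become nonnegative. *)
Lemma measurable_tri_char : measurable_fun setT tri_char.
Proof.
pose f (z : R * (M * M)) := 1 + cos (z.1 * z.2.1 - z.1 * z.2.2).
have mg : measurable_fun setT
    (fun z : R * (M * M) => z.1 * z.2.1 - z.1 * z.2.2).
  apply: measurable_funB; apply: measurable_funM => //.
    exact: (measurableT_comp measurable_fst measurable_snd).
  exact: (measurableT_comp measurable_snd measurable_snd).
have mf : measurable_fun setT f.
  by apply: measurable_funD => //; exact: measurableT_comp (@measurable_cosine R) mg.
pose UU : probability (M * M)%type R := (U \x U)%E.
have mF := @measurable_fun_fubini_tonelli_F _ _ _ _ _ UU (EFin \o f).
rewrite (_ : tri_char = fun y => fine (fubini_F UU (EFin \o f) y) - 1).
  apply: measurable_funB => //.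
  apply: (measurableT_comp (@fine_measurable R _ measurableT)).
  apply: mF; first exact/measurable_EFinP.
  by move=> z; rewrite lee_fin /f -lerBlDl sub0r cos_geN1.
apply/funext => y.
have my : measurable_fun setT (fun w : M * M => y * w.1 - y * w.2).
  by apply: measurable_funB; apply: measurable_funM.
rewrite /tri_char charsqE//.
transitivity (\int[(U \x U)%E]_w (1 + cos (y * w.1 - y * w.2)) - 1) => //.
rewrite RintegralD//; first by rewrite Rintegral_cst1; ring.
  by apply: (@bounded_integrableP _ _ _ (U \x U)%E 1) => // x; rewrite normr1.
exact: (@integrable_cos _ _ _ (U \x U)%E (fun w : M * M => y * w.1 - y * w.2)).
Qed.

Let unit_cst (b : R) : \int[lebesgue_measure]_(u in `[0%R, 1%R]) b = b.
Proof.
rewrite Rintegral_cst. 2: by apply: measurable_itv.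
rewrite [X in fine X](_ : _ = 1%E) ?mulr1//.
by rewrite [LHS]lebesgue_measure_itv/= lte_fin ltr01 oppr0 adde0.
Qed.

(** The shift by the bound B reduces this to nonnegative functions. *)
Let Uint (f : M -> R) B : measurable_fun setT f -> (forall x, `|f x| <= B) ->
  \int[U]_u f u = \int[lebesgue_measure]_(u in `[0, 1]) f u.
Proof.
move=> mf bf.
have fM x : 0 <= f x + B by have := bf x; rewrite ler_norml; lra.
have IM : U.-integrable setT (EFin \o (fun=> B)).
  by apply: (@bounded_integrableP _ _ _ U `|B|).
have If : U.-integrable setT (EFin \o f) by exact: bounded_integrableP bf.
have : \int[U]_u (f u + B) = \int[lebesgue_measure]_(u in `[0, 1]) (f u + B).
  rewrite /Rintegral integral_uniform; last 2 first.
  - by apply/measurable_EFinP; exact: measurable_funD.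
  - by move=> x; rewrite lee_fin.
  by rewrite subr0 invr1 mul1e.
have I01 : (lebesgue_measure `[0%R, 1%R]%classic < +oo :> \bar R)%E.
  by rewrite /= lebesgue_measure_itv/= lte_fin ltr01 ltry.
rewrite RintegralD// RintegralD//; last 2 first.
- apply: measurable_bounded_integrable => //; first exact: measurable_funTS.
  by exists B; split; rewrite ?num_real// => y My x _; exact: (le_trans (bf x) (ltW My)).
- apply: measurable_bounded_integrable => //.
  by exists `|B|; split; rewrite ?num_real// => y My x _; exact: ltW.
by rewrite Rintegral_cst1 unit_cst => /addIr.
Qed.

(** For |y| <= 1 and u in [0, 1] the angle y u stays in [-1, 1], where the
cosine is at least cos 1 > 0. *)
Lemma tri_char_cos1 y : `|y| <= 1 -> cos 1 ^+ 2 <= tri_char y.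
Proof.
move=> y1; rewrite /tri_char /charsq.
have c1 : cos 1 <= \int[U]_u cos (y * u).
  rewrite (@Uint _ 1); last 2 first.
  - exact: measurableT_comp (@measurable_cosine R) (mlin y).
  - by move=> x; exact: cos_max.
  have -> : cos 1 = \int[lebesgue_measure]_(u in `[0, 1]) cos (1:R).
    by rewrite unit_cst.
  have I01 : (lebesgue_measure `[0%R, 1%R]%classic < +oo :> \bar R)%E.
    by rewrite /= lebesgue_measure_itv/= lte_fin ltr01 ltry.
  apply: le_Rintegral => //.
  - apply: measurable_bounded_integrable => //.
    by exists `|cos (1:R)|; split; rewrite ?num_real// => z My x _; exact: ltW.
  - apply: measurable_bounded_integrable => //.
      apply: measurable_funTS.
      exact: measurableT_comp (@measurable_cosine R) (mlin y).
    by exists 1; split; rewrite ?num_real// => z My x _; exact: (le_trans (cos_max _) (ltW My)).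
  - move=> u /=; rewrite in_itv/= => /andP[u0 u1].
    have yu1 : `|y * u| <= 1 by rewrite normrM (ger0_norm u0) mulr_ile1.
    have pi2 : (1 : R) <= pi by rewrite (le_trans _ (@pi_ge2 R)) ?ler1n.
    rewrite -(cos_norm (y * u)); move: yu1; rewrite le_eqVlt => /orP[/eqP ->//|yu1].
    rewrite ltW// ltr_cos// in_itv/= ?normr_ge0 ?ler01//=.
    by rewrite (le_trans (ltW yu1)).
have cos10 : 0 < cos (1:R) := @cos1_gt0 R.
rewrite -[leLHS]addr0 lerD ?sqr_ge0// ler_pXn2r// nnegrE ltW//.
exact: lt_le_trans c1.
Qed.

Let unit_FTC (f F : R -> R) : continuous f -> (forall x : R, is_derive x (1:R) F (f x)) ->
  \int[lebesgue_measure]_(u in `[0, 1]) f u = F 1 - F 0.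
Proof.
move=> cf dF.
have cF : continuous F.
  by move=> x; apply: differentiable_continuous; apply/derivable1_diffP; exact: ex_derive.
rewrite /Rintegral (@continuous_FTC2 _ _ F)//.
- by apply: continuous_subspaceT.
- split.
  + by move=> x _; exact: ex_derive.
  + by apply: cvg_at_right_filter; exact: cF.
  + by apply: cvg_at_left_filter; exact: cF.
- by move=> x _; rewrite derive1E; exact: derive_val.
Qed.

Let dmul (y x : R) : is_derive x (1:R) (fun u : R => y * u) y.
Proof. by have := @is_deriveZ R R R id y x 1 1 _; rewrite /GRing.scale/= mulr1; apply. Qed.

(** Explicitly, tri_char y = (2 - 2 cos y) / y^2, by integration of cos (y u) and
sin (y u) over [0, 1]. *)
Lemma tri_char_decay y : y != 0 -> tri_char y <= 4 / y ^+ 2.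
Proof.
move=> y0.
have cmul : continuous (fun u : R => y * u) by move=> x; exact: mulrl_continuous.
have ci : \int[U]_u cos (y * u) = sin y / y.
  rewrite (@Uint _ 1); last 2 first.
  - exact: measurableT_comp (@measurable_cosine R) (mlin y).
  - by move=> x; exact: cos_max.
  have cf : continuous (fun u : R => cos (y * u)).
    by move=> x; apply: continuous_comp; [exact: cmul|exact: continuous_cos].
  have dF (x : R) : is_derive x (1:R) (fun u : R => y^-1 * sin (y * u)) (cos (y * x)).
    have d2 := is_derive1_comp (is_derive_sin (y * x)) (dmul y x).
    have := @is_deriveZ R R R _ (y^-1) x 1 _ d2.
    rewrite /GRing.scale/= => d3; apply: is_derive_eq d3 _.
    by field.
  rewrite (unit_FTC cf dF) mulr1 mulr0 sin0; ring.
have si : \int[U]_u sin (y * u) = (1 - cos y) / y.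
  rewrite (@Uint _ 1); last 2 first.
  - exact: measurableT_comp (@measurable_sine R) (mlin y).
  - by move=> x; exact: sin_max.
  have cf : continuous (fun u : R => sin (y * u)).
    by move=> x; apply: continuous_comp; [exact: cmul|exact: continuous_sin].
  have dF (x : R) : is_derive x (1:R) (fun u : R => (- y^-1) * cos (y * u)) (sin (y * x)).
    have d2 := is_derive1_comp (is_derive_cos (y * x)) (dmul y x).
    have := @is_deriveZ R R R _ ((- y^-1)) x 1 _ d2.
    rewrite /GRing.scale/= => d3; apply: is_derive_eq d3 _.
    by field.
  rewrite (unit_FTC cf dF) mulr1 mulr0 cos0; ring.
have -> : tri_char y = (2 - 2 * cos y) / y ^+ 2.
  rewrite /tri_char /charsq ci si; have := cos2Dsin2 y => cs.
  have -> : 2 - 2 * cos y = cos y ^+ 2 + sin y ^+ 2 + 1 - 2 * cos y by rewrite cs; ring.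
  by field.
rewrite ler_pM2r ?invr_gt0 ?exprn_even_gt0//.
by have := cos_geN1 y; lra.
Qed.

End triangular_kernel.

Section triangular_vector.
Variable R : realType.

Let M := measurableTypeR R.
Let U : probability M R := uniform_prob (@ltr01 R).

(** The probability space is built by induction on the dimension: each new
coordinate is the difference of two fresh uniform variables.  The statement on
sines keeps the addition formula for cosines multiplicative. *)
Lemma triangular_vector (m : nat) :
  exists (dO : measure_display) (Om : measurableType dO) (mu : probability Om R)
    (t : Om -> nat -> R),
    (forall i, measurable_fun setT (fun o => t o i)) /\
    forall y : nat -> R,
      \int[mu]_o cos (\sum_(i < m) t o i * y i) = \prod_(i < m) tri_char (y i) /\
      \int[mu]_o sin (\sum_(i < m) t o i * y i) = 0.
Proof.
elim: m => [|m [dO [Om [mu [t [mt tE]]]]]].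
  exists _, M, U, (fun _ _ => 0); split => // y.
  rewrite big_ord0; split.
    by under eq_Rintegral do rewrite big_ord0 cos0; rewrite Rintegral_cst1.
  by under eq_Rintegral do rewrite big_ord0 sin0; rewrite Rintegral_cst1.
pose UU : probability (M * M)%type R := (U \x U)%E.
pose t' (z : Om * (M * M)) i : R :=
  if (i < m)%N then t z.1 i else z.2.1 - z.2.2.
exists _, (Om * (M * M))%type, (mu \x UU)%E, t'; split=> [i|y].
  rewrite /t'; case: (i < m)%N.
    exact: (measurableT_comp (mt i)).
  apply: measurable_funB.
    exact: (measurableT_comp measurable_fst measurable_snd).
  exact: (measurableT_comp measurable_snd measurable_snd).
have [tc ts] := tE y.
have mS : measurable_fun setT (fun o => \sum_(i < m) t o i * y i).
  by apply: measurable_sum => i; exact: measurable_funM.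
have my : measurable_fun setT (fun u : M => y m * (u : R)).
  by have : measurable_fun setT (fun u : R => y m * u) by exact: measurable_funM.
have mD : measurable_fun setT (fun w : M * M => y m * w.1 - y m * w.2).
  by apply: measurable_funB; exact: (measurableT_comp my).
have S' z : \sum_(i < m.+1) t' z i * y i =
    \sum_(i < m) t z.1 i * y i + (y m * z.2.1 - y m * z.2.2).
  rewrite big_ord_recr/= /t' ltnn; congr (_ + _); last by ring.
  by apply: eq_bigr => i _; rewrite ltn_ord.
have c' : \int[UU]_w cos (y m * w.1 - y m * w.2) = tri_char (y m).
  by rewrite /tri_char charsqE.
have s' : \int[UU]_w sin (y m * w.1 - y m * w.2) = 0.
  exact: (Rintegral_sinB_eq0 _ my).
split.
  under eq_Rintegral do rewrite S'.
  by rewrite (Rintegral_cosD mu UU mS mD) ts tc c' big_ord_recr/= mul0r subr0.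
under eq_Rintegral do rewrite S'.
by rewrite (Rintegral_sinD mu UU mS mD) ts s' mul0r mulr0 addr0.
Qed.

End triangular_vector.

(** * Integrals of kernels and probabilities of cells *)

Section small_ball.
Local Open Scope ereal_scope.
Context d (T : measurableType d) (R : realType) (mu : {measure set T -> \bar R}).
Variables (k : R -> R) (w c : nat -> R) (C : R) (r : R).
Hypotheses (mk : measurable_fun setT k) (k0 : forall y, (0 <= k y)%R).
Hypotheses (w0 : forall j, (0 <= w j)%R) (wC : \sum_(j <oo) (w j)%:E <= C%:E).
Hypothesis cover : forall y, exists2 j, (`|y - c j| <= r)%R & (k y <= w j)%R.
Variable U : nat -> T -> R.
Hypothesis mU : forall i, measurable_fun setT (U i).

Let prodk m t : R := \prod_(i < m) k (U i t).

Let prodk_ge0 m t : (0 <= prodk m t)%R.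
Proof. exact: prodr_ge0. Qed.

Let mprodk m (D : set T) : measurable D -> measurable_fun D (EFin \o prodk m).
Proof.
move=> mD; apply/measurable_EFinP; apply: measurable_funTS.
by apply: measurable_prod => i _; exact: measurableT_comp.
Qed.

Let slab m x : set T := [set t | `|U m t - x| <= r]%R.

Let mslab m x : measurable (slab m x).
Proof.
have mN : measurable_fun setT (fun t => `|U m t - x|)%R.
  by apply: measurableT_comp => //; exact: measurable_funB.
rewrite (_ : slab m x = [set: T] `&` (fun t => `|U m t - x|%R) @^-1` `]-oo, r]).
  exact: mN.
by rewrite setTI; apply/seteqP; split => t /=; rewrite /slab/= in_itv.
Qed.

Lemma measurable_cell m (x : nat -> R) :
  measurable [set t | forall i, (i < m)%N -> (`|U i t - x i| <= r)%R].
Proof.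
rewrite (_ : mkset _ = \bigcap_i (if (i < m)%N then slab i (x i) else setT)).
  by apply: bigcapT_measurable => i; case: ifP.
apply/seteqP; split => t /=; first by move=> h i _; case: ifP => // /h.
by move=> h i im; have := h i I; rewrite im.
Qed.

(** If a kernel k on the line is dominated by a convergent sum of weights on
intervals of half-length r, the integral of a product of such kernels is
controlled by the largest measure of a cube of half-side r.  The set D makes the
induction on m possible: decomposing the last factor over the intervals
restricts D to slabs. *)
Lemma integral_prod_le_cell m (D : set T) (B : R) : measurable D ->
  (forall x : nat -> R,
    mu (D `&` [set t | forall i, (i < m)%N -> (`|U i t - x i| <= r)%R]) <= B%:E) ->
  \int[mu]_(t in D) (\prod_(i < m) k (U i t))%:E <= (C ^+ m * B)%:E.
Proof.
have C0 : (0 <= C)%R.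
  by rewrite -lee_fin (le_trans _ wC)// nneseries_ge0// => j _ _; rewrite lee_fin.
elim: m D B => [|m IH] D B mD DB.
  have := DB (fun=> 0%R); rewrite (_ : _ `&` _ = D); last first.
    by apply/seteqP; split => // t [].
  under eq_integral do rewrite big_ord0.
  by rewrite integral_cst// mul1e expr0 mul1r.
have B0 : (0 <= B)%R by rewrite -lee_fin; exact: le_trans (DB (fun=> 0%R)).
pose A j := slab m (c j).
pose F j t := (w j)%:E * ((fun t => (prodk m t)%:E) \_ (A j)) t.
have F0 j t : 0 <= F j t.
  by rewrite mule_ge0 ?lee_fin//; apply: erestrict_ge0 => u _; rewrite lee_fin.
have mA j : measurable_fun D ((fun t => (prodk m t)%:E) \_ (A j)).
  apply: (measurable_restrict (fun t => (prodk m t)%:E) (mslab m (c j)) mD).1.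
  by apply: mprodk; exact: measurableI.
have mF j : measurable_fun D (F j) by exact: measurable_funeM.
have le1 t : (prodk m.+1 t)%:E <= \sum_(j <oo) F j t.
  have [j Uj kj] := cover (U m t).
  apply: le_trans (nneseries_lim_ge j.+1 _) => //.
  rewrite big_nat_recr//=.
  apply: (@le_trans _ _ (F j t)); last by rewrite leeDr// sume_ge0.
  rewrite /F patchE mem_set// -EFinM lee_fin.
  rewrite /prodk big_ord_recr/= mulrC.
  apply: ler_wpM2r => //; exact: prodk_ge0.
apply: (@le_trans _ _ (\int[mu]_(t in D) \sum_(j <oo) F j t)).
  apply: ge0_le_integral => //.
  - by move=> t _; rewrite lee_fin prodr_ge0.
  - exact: mprodk.
  - by apply: ge0_emeasurable_sum.
- by move=> t _; exact: le1.
rewrite integral_nneseries//.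
have Fle j : \int[mu]_(t in D) F j t <= (C ^+ m * B)%:E * (w j)%:E.
  rewrite ge0_integralZl_EFin//; last first.
    by move=> t _; apply: erestrict_ge0 => u _; rewrite lee_fin.
  rewrite -integral_mkcondr muleC.
  apply: lee_wpmul2r; first by rewrite lee_fin.
  apply: IH => [|x]; first by apply: measurableI => //; exact: mslab.
  apply: le_trans (DB (fun i => if i == m then c j else x i)).
  rewrite le_measure// ?inE.
  - apply: measurableI; last exact: measurable_cell.
    by apply: measurableI => //; exact: mslab.
  - by apply: measurableI => //; exact: measurable_cell.
  - move=> t [[Dt At] xt]; split => // i; rewrite ltnS leq_eqVlt.
    case: eqP => [->//|_ /= im]; exact: xt.
apply: (@le_trans _ _ (\sum_(j <oo) ((C ^+ m * B)%:E * (w j)%:E))).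
  by apply: lee_nneseries => // j _ _; exact: integral_ge0.
rewrite nneseriesZl; last by move=> j _; rewrite lee_fin.
rewrite (_ : (C ^+ m.+1 * B)%:E = (C ^+ m * B)%:E * C%:E).
  by rewrite lee_wpmul2l// lee_fin mulr_ge0// exprn_ge0.
by rewrite -EFinM; congr EFin; rewrite exprSr; ring.
Qed.

End small_ball.

(** The intervals of half-length r centred at the points +-(2j+1) r cover the
line; these centres are listed by n = 2j and n = 2j+1.  On the intervals of
index j, tri_char is at most min(1, 1 / (j r)^2), and the weights are chosen so
that their sum telescopes. *)
Lemma tri_char_cover (R : realType) (r : R) : 0 < r <= 1 ->
  exists w c : nat -> R, [/\ forall j, 0 <= w j,
    (\sum_(j <oo) (w j)%:E <= (20 / r ^+ 2)%:E)%E &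
    forall y, exists2 j, `|y - c j| <= r & tri_char y <= w j].
Proof.
move=> /andP[r0 r1]; pose K := 20 / r ^+ 2.
have K0 : 0 < K by rewrite divr_gt0// exprn_gt0.
pose w (n : nat) : R := K / (n.+1%:R * n.+2%:R).
pose c (n : nat) : R := (-1) ^+ odd n * ((n./2)%:R * 2 + 1) * r.
have w0 n : 0 <= w n by rewrite divr_ge0 ?ltW// mulr_gt0.
exists w, c; split => //.
  apply: lime_le; first by apply: is_cvg_nneseries => n _ _; rewrite lee_fin.
  apply: nearW => N; rewrite sumEFin lee_fin.
  have -> : \sum_(0 <= n < N) w n = K * (1 - N.+1%:R^-1).
    elim: N => [|N IH]; first by rewrite big_nil invr1 subrr mulr0.
    rewrite big_nat_recr//= IH /w -!natr1; field.
    by rewrite !natr1 !pnatr_eq0.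
  by rewrite ler_piMr ?ltW// lerBlDr lerDl invr_ge0.
move=> y; pose j := Num.truncn (`|y| / (2 * r)).
have r2 : 0 < 2 * r by rewrite mulr_gt0.
have /andP[jy yj] : j%:R * (2 * r) <= `|y| < j.+1%:R * (2 * r).
  by rewrite -ler_pdivlMr// -ltr_pdivrMr// truncn_itv// divr_ge0// ltW.
(* the parity of n encodes the sign of y *)
pose n := ((y < 0)%R + j.*2)%N.
have on : odd n = (y < 0) by rewrite /n oddD odd_double addbF; case: (y < 0).
have hn : n./2 = j by rewrite /n half_bit_double.
exists n.
  rewrite /c on hn; move: jy yj; rewrite -natr1.
  case: (ltrP y 0) => y0; rewrite ?expr1 ?expr0 ler_norml.
    by rewrite ltr0_norm// => jy yj; lra.
  by rewrite ger0_norm// => jy yj; lra.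
have n2 : (n <= j.*2.+1)%N by rewrite /n; case: (y < 0).
apply: (@le_trans _ _ (K / (j.*2.+2%:R * j.*2.+3%:R))); last first.
  rewrite /w ler_pM2l// lef_pV2 ?posrE ?mulr_gt0//.
  by rewrite ler_pM// ler_nat.
have j2 : (j.*2)%:R = j%:R * 2 :> R by rewrite -muln2 natrM.
have [j0|j0] := posnP j.
  apply: le_trans (tri_char_le1 y) _.
  rewrite j0 /= /K ler_pdivlMr ?mulr_gt0// ler_pdivlMr ?exprn_gt0//.
  have : r ^+ 2 <= 1 by rewrite expr_le1// ltW.
  by rewrite -[(0.*2.+2)%N]/2%N -[(0.*2.+3)%N]/3%N => r21; lra.
have j1 : (1 : R) <= j%:R by rewrite ler1n.
have y0 : y != 0.
  by rewrite -normr_gt0; apply: lt_le_trans jy; rewrite mulr_gt0// ltr0n.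
apply: le_trans (tri_char_decay y0) _.
have y2 : (j%:R * (2 * r)) ^+ 2 <= y ^+ 2.
  by rewrite -[leRHS]real_normK ?num_real// ler_sqr ?nnegrE// mulr_ge0// ltW.
apply: (@le_trans _ _ (4 / (j%:R * (2 * r)) ^+ 2)).
  have jr0 : 0 < (j%:R * (2 * r)) ^+ 2 by rewrite exprn_gt0// mulr_gt0// ltr0n.
  by rewrite ler_pM2l// lef_pV2 ?posrE// (lt_le_trans jr0).
have -> : 4 / (j%:R * (2 * r)) ^+ 2 = K / (20 * j%:R ^+ 2).
  by rewrite /K; field; rewrite ?(gt_eqF r0) ?pnatr_eq0 -?lt0n ?j0.
rewrite ler_pM2l// lef_pV2 ?posrE ?mulr_gt0// ?exprn_gt0 ?ltr0n//.
rewrite -[j.*2.+3%:R]natr1 -[j.*2.+2%:R]natr1 -[j.*2.+1%:R]natr1 j2.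
nra.
Qed.

(** * Euclidean balls and Borel sets *)

Section dot_product.
Variables (R : realType) (d : nat).
Implicit Types u v : 'rV[R]_d.

Lemma dotZl r u v : dot (r *: u) v = r * dot u v.
Proof. by rewrite /dot mulr_sumr; apply: eq_bigr => i _; rewrite mxE mulrA. Qed.

Lemma dotZr r u v : dot u (r *: v) = r * dot u v.
Proof. by rewrite /dot mulr_sumr; apply: eq_bigr => i _; rewrite mxE mulrCA. Qed.

Lemma dotBr u v w : dot u (v - w) = dot u v - dot u w.
Proof. by rewrite /dot -sumrB; apply: eq_bigr => i _; rewrite !mxE mulrBr. Qed.

Lemma dot_sumr (I : finType) u (f : I -> R) (v : I -> 'rV[R]_d) :
  dot u (\sum_k f k *: v k) = \sum_k f k * dot u (v k).
Proof.
rewrite /dot; under eq_bigr do rewrite summxE mulr_sumr.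
rewrite exchange_big/=; apply: eq_bigr => k _.
by rewrite mulr_sumr; apply: eq_bigr => i _; rewrite mxE mulrCA.
Qed.

Lemma measurable_dot dT (T : measurableType dT) (Y Z : T -> 'rV[R]_d) :
  (forall i, measurable_fun setT (fun w => Y w 0 i)) ->
  (forall i, measurable_fun setT (fun w => Z w 0 i)) ->
  measurable_fun setT (fun w => dot (Y w) (Z w)).
Proof. by move=> mY mZ; apply: measurable_sum => i; exact: measurable_funM. Qed.

End dot_product.

Section borel_vectors.
Variables (R : realType) (d : nat).

Lemma measurable_coord (i : 'I_d) :
  measurable_fun setT (fun y : borel_rV R d => (y : 'rV[R]_d) 0 i).
Proof.
apply: (measurability _ (RGenOpens.measurableE R)) => _ [_ [a [b ->] <-]].
rewrite setTI; apply: sub_gen_smallest.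
have := @coord_continuous R 1 d 0 i => /continuousP; apply.
exact: interval_open.
Qed.

Lemma dot_ge0 (x : 'rV[R]_d) : 0 <= dot x x.
Proof. by apply: sumr_ge0 => i _; rewrite -expr2 sqr_ge0. Qed.

Lemma dilated_ballP (x y : 'rV[R]_d) (l : R) : 0 < l ->
  dilated_ball x l%:E y <-> dot (y - x) (y - x) <= (l / 2) ^+ 2.
Proof.
move=> l0; have halfE (b : 'rV[R]_d) : (enorm b <= 2^-1) = (dot b b <= 2^-1 ^+ 2).
  by rewrite -(@ler_pXn2r _ 2) ?nnegrE ?sqrtr_ge0// sqr_sqrtr// dot_ge0.
have dotZ (r : R) (b : 'rV[R]_d) : dot (r *: b) (r *: b) = r ^+ 2 * dot b b.
  by rewrite dotZl dotZr; ring.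
split => [[b]|yx].
  rewrite /half_ball/= halfE => b2 <-; rewrite (addrC x) addrK dotZ exprMn.
  by rewrite ler_wpM2l// sqr_ge0.
exists (l^-1 *: (y - x)); last by rewrite scalerA divff ?gt_eqF// scale1r subrKC.
rewrite /half_ball/= halfE dotZ.
have -> : 2^-1 ^+ 2 = l^-1 ^+ 2 * (l / 2) ^+ 2 by field; rewrite gt_eqF.
by rewrite ler_wpM2l// sqr_ge0.
Qed.

Context dT (T : measurableType dT) (Y : T -> 'rV[R]_d).
Hypothesis mY : forall i, measurable_fun setT (fun w => Y w 0 i).

Lemma measurable_preimage_ball (x : 'rV[R]_d) (l : R) : 0 < l ->
  measurable (Y @^-1` dilated_ball x l%:E).
Proof.
move=> l0; pose f w := dot (Y w - x) (Y w - x).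
have mf : measurable_fun setT f.
  apply: measurable_sum => i; apply: measurable_funM;
  under eq_fun do rewrite !mxE; exact: measurable_funB.
rewrite (_ : _ @^-1` _ = [set: T] `&` f @^-1` `]-oo, (l / 2) ^+ 2]); first exact: mf.
by rewrite setTI; apply/seteqP; split => w /=; rewrite in_itv/=;
  [move/(dilated_ballP _ _ l0)|move=> h; apply/(dilated_ballP _ _ l0)].
Qed.

Definition tri_char_vec (u : 'rV[R]_d) : R := \prod_i tri_char (u 0 i).

Lemma tri_char_vec_ge0 u : 0 <= tri_char_vec u.
Proof. by apply: prodr_ge0 => i _; exact: tri_char_ge0. Qed.

Lemma tri_char_vec_le1 u : tri_char_vec u <= 1.
Proof. by apply: prodr_ile1 => i _; rewrite tri_char_ge0 tri_char_le1. Qed.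

Lemma measurable_tri_char_vec (r : R) (x : 'rV[R]_d) :
  measurable_fun setT (fun w => tri_char_vec (r *: (Y w - x))).
Proof.
apply: measurable_prod => i _; apply: measurableT_comp; first exact: measurable_tri_char.
by under eq_fun do rewrite !mxE; apply: measurable_funM => //; exact: measurable_funB.
Qed.

(** On the ball all coordinates of (Y w - x) / l are at most 1 in absolute
value, so each of the d factors of the kernel is at least cos(1)^2. *)
Lemma ball_le_tri_char_vec (P : probability T R) (x : 'rV[R]_d) (l : R) : 0 < l ->
  (P (Y @^-1` dilated_ball x l%:E) <=
   ((cos 1 ^- (2 * d)) * \int[P]_w tri_char_vec (l^-1 *: (Y w - x)))%:E)%E.
Proof.
move=> l0; set A := _ @^-1` _.
have mA : measurable A by exact: measurable_preimage_ball.
have c0 : 0 < cos (1 : R) := @cos1_gt0 R.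
have Ik : P.-integrable setT (EFin \o (fun w => tri_char_vec (l^-1 *: (Y w - x)))).
  apply: (@bounded_integrableP _ _ _ _ 1); first exact: measurable_tri_char_vec.
  by move=> w; rewrite ger0_norm ?tri_char_vec_ge0// tri_char_vec_le1.
rewrite -RintegralZl// EFin_Rintegral; last first.
  by have := integrableZl measurableT (cos 1 ^- (2 * d)) Ik.
rewrite -(setIT A) -integral_indic//.
apply: ge0_le_integral => //.
- by apply/measurable_EFinP.
- by apply/measurable_EFinP; apply: measurable_funM => //; exact: measurable_tri_char_vec.
move=> w _; rewrite indicE; case: (boolP (w \in A)); last first.
  by rewrite lee_fin mulr_ge0 ?tri_char_vec_ge0// invr_ge0 exprn_ge0// ltW.
rewrite inE => /(dilated_ballP _ _ l0) Aw.
rewrite lee_fin mulrC ler_pdivlMr ?exprn_gt0// mul1r exprM.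
rewrite -[X in _ ^+ X](card_ord d) -prodr_const ler_prod// => i _.
have li0 : 0 <= l^-1 by rewrite invr_ge0 ltW.
rewrite sqr_ge0 tri_char_cos1// !mxE normrM (ger0_norm li0).
rewrite ler_pdivrMl// mulr1.
rewrite -(@ler_pXn2r _ 2) ?nnegrE ?normr_ge0 ?(ltW l0)// real_normK ?num_real//.
have li : (Y w 0 i - x 0 i) ^+ 2 <= dot (Y w - x) (Y w - x).
  by rewrite /dot (bigD1 i)//= !mxE -expr2 lerDl sumr_ge0// => j _; rewrite -expr2 sqr_ge0.
apply: le_trans li (le_trans Aw _).
by rewrite expr_div_n ler_pdivrMr// ler_peMr ?sqr_ge0// -natrX ler1n.
Qed.

End borel_vectors.

(** Where the coordinates of z y / tau vary in a cube of half-side 1 / (2 d),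
d being the dimension, y varies in a cube of half-diagonal at most
tau / (2 |z|), which lies in a ball dilated by tau / |z|.  For z = 0 the kernel
is 1 and the ball is the whole space. *)
Lemma small_ball_tri_char_vec (R : realType) (d : nat) (H : probability (borel_rV R d.+1) R)
    (tau z : R) : 0 < tau ->
  (\int[H]_y (tri_char_vec ((z / tau) *: (y : 'rV[R]_d.+1)))%:E <=
   ((80 * d.+1%:R ^+ 2) ^+ d.+1)%:E * concentration H (div_norm tau z))%E.
Proof.
move=> tau0; set K := 80 * d.+1%:R ^+ 2.
have d0 : (0 : R) < d.+1%:R by rewrite ltr0n.
have K1 : 1 <= K.
  have : (1 : R) <= d.+1%:R ^+ 2 by rewrite -natrX ler1n expn_gt0.
  by rewrite /K; lra.
have [->|z0] := eqVneq z 0.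
  under eq_integral => y _.
    have -> : tri_char_vec ((0 / tau) *: (y : 'rV[R]_d.+1)) = 1.
      by rewrite /tri_char_vec big1// => i _; rewrite !mxE mul0r mul0r tri_char0.
    over.
  have HT : H setT = 1%E by exact: probability_setT.
  rewrite integral_cst// mul1e [leLHS](_ : _ = 1%E); last exact: probability_setT.
  apply: (@le_trans _ _ (1%:E * 1)%E); first by rewrite mule1.
  apply: lee_pmul => //; first by rewrite lee_fin exprn_ege1.
  apply: (@le_trans _ _ (H setT)); first by rewrite HT.
  apply: ereal_sup_ubound; exists 0 => //.
  by rewrite /div_norm eqxx.
have nz0 : 0 < `|z| by rewrite normr_gt0.
pose l := tau / `|z|; have l0 : 0 < l by rewrite divr_gt0.
have -> : div_norm tau z = l%:E by rewrite /div_norm (negbTE z0).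
have mid i : measurable_fun setT (fun y : borel_rV R d.+1 => (y : 'rV[R]_d.+1) 0 i).
  exact: measurable_coord.
have mball x : measurable (dilated_ball x l%:E : set (borel_rV R d.+1)).
  exact: (measurable_preimage_ball mid).
set Q := concentration H l%:E.
have Qge x : (H (dilated_ball x l%:E) <= Q)%E.
  by apply: ereal_sup_ubound; exists x.
have Q0 : (0 <= Q)%E by exact: le_trans (Qge 0).
have Q1 : (Q <= 1)%E.
  by apply: ge_ereal_sup => _ [x _ <-]; exact: probability_le1.
have Qfin : Q \is a fin_num by rewrite ge0_fin_numE// (le_lt_trans Q1)// ltry.
rewrite -(fineK Qfin) -EFinM.
pose r : R := (2 * d.+1%:R)^-1.
have r01 : 0 < r <= 1.
  rewrite invr_gt0 mulr_gt0//= invf_le1 ?mulr_gt0//.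
  have : (1 : R) <= d.+1%:R by rewrite ler1n.
  lra.
have rK : 20 / r ^+ 2 = K.
  by rewrite /r /K; field; rewrite gt_eqF.
have [w [c [w0 wK wc]]] := tri_char_cover r01; rewrite rK in wK.
pose U i (y : borel_rV R d.+1) := z / tau * (y : 'rV[R]_d.+1) 0 (inord i).
have mU i : measurable_fun setT (U i) by exact: measurable_funM.
have := @integral_prod_le_cell _ _ _ H _ w c K r (@measurable_tri_char R) (@tri_char_ge0 R)
  w0 wK wc U mU d.+1 setT (fine Q) measurableT.
rewrite [X in (_ -> X <= _)%E -> _](_ : _ =
    \int[H]_y (tri_char_vec ((z / tau) *: (y : 'rV[R]_d.+1)))%:E)%E; last first.
  apply: eq_integral => y _; congr EFin; apply: eq_bigr => i _.
  by rewrite /U inord_val !mxE.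
apply=> x; rewrite setTI fineK//.
apply: le_trans (Qge ((tau / z) *: \row_i x i)).
apply: le_measure; rewrite ?inE//.
  exact: (measurable_cell r mU).
move=> y /= xy; apply/dilated_ballP => //.
apply: (@le_trans _ _ (\sum_(i < d.+1) (l * r) ^+ 2)).
  apply: ler_sum => i _; rewrite -expr2 !mxE.
  have := xy i (ltn_ord i); rewrite /U inord_val => xyi.
  rewrite -[leLHS]real_normK ?num_real// ler_pXn2r ?nnegrE ?normr_ge0//; last first.
    by rewrite mulr_ge0// ltW//; case/andP: r01.
  have -> : y 0 i - tau / z * x i = tau / z * (z / tau * y 0 i - x i).
    by field; rewrite z0 gt_eqF.
  rewrite normrM normf_div (gtr0_norm tau0) -/l.
  by rewrite ler_wpM2l// ltW.
rewrite sumr_const card_ord -[_ *+ d.+1]mulr_natr.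
have -> : (l * r) ^+ 2 * d.+1%:R = (l / 2) ^+ 2 * d.+1%:R^-1.
  by rewrite /r; field; rewrite gt_eqF.
by rewrite ler_piMr ?sqr_ge0// invf_le1// ler1n.
Qed.

(** The integral of a nonnegative function is a supremum over the simple functions
below it, hence monotone for arbitrary functions.  This serves for
g z = concentration H (div_norm tau z). *)
Lemma le_integral_nneg (R : realType) dT (T : measurableType dT)
    (mu : {measure set T -> \bar R}) (f g : T -> \bar R) :
  (forall x, (0 <= f x)%E) -> (forall x, (f x <= g x)%E) ->
  (\int[mu]_x f x <= \int[mu]_x g x)%E.
Proof.
move=> f0 fg; have g0 x : (0 <= g x)%E by exact: le_trans (f0 x) (fg x).
rewrite !ge0_integralTE// ge_ereal_sup// => _ [h hf <-].
by apply: ereal_sup_ubound; exists h => // x; exact: le_trans (hf x) (fg x).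
Qed.

(** * The concentration inequality *)

Theorem theorem1 (R : realType) (d : nat) (hd : (1 <= d)%N) :
  exists c : R, 0 < c /\
  forall (n : nat) (hn : (1 <= n)%N)
    (dT : measure_display) (T : measurableType dT) (P : probability T R)
    (X : {RV P >-> R}) (Xs : 'I_n -> {RV P >-> R})
    (* X, X_1, ..., X_n as one family *)
    (hindep : mutually_independent (fun o : option 'I_n => oapp Xs X o))
    (hident : identically_distributed (fun o : option 'I_n => oapp Xs X o))
    (a : 'I_n -> 'rV[R]_d)
    (V : {measure set R -> \bar R})
    (hV0 : (0 < V setT)%E)
    (hVG : forall B : set R, measurable B ->
      (V B <= symmetrized_distribution X B)%E)
    (H : probability (borel_rV R d) R)
    (hH : forall t : 'rV[R]_d, charfun H t =
      (expR (- ((total_mass V)%:num / 2 *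
        \sum_(k < n) (1 - cos (dot t (a k))))))%:C%C)
    (tau : R) (htau : 0 < tau),
  (concentration (weighted_sum_distribution Xs a) tau%:E <=
    c%:E * \int[normalized V]_z
      concentration H (div_norm tau z))%E.
Proof.
case: d hd => // d _.
pose C1 : R := cos 1 ^- (2 * d.+1); pose C2 : R := (80 * d.+1%:R ^+ 2) ^+ d.+1.
have C10 : 0 < C1 by rewrite invr_gt0 exprn_gt0// cos1_gt0.
have C20 : 0 < C2 by rewrite exprn_gt0// mulr_gt0// exprn_gt0.
exists (C1 * C2); split; first exact: mulr_gt0.
move=> n _ dT T P X Xs hindep hident a V hV0 hVG H hH tau tau0.
have Xs_indep : mutually_independent Xs.
  move=> J A mA.
  have := hindep (Some @: J) (fun o => oapp A setT o).
  rewrite big_imset/=; last by move=> i j _ _ [].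
  move=> <-; last by case=> [k|] /=; [exact: mA|exact: measurableT].
  congr (P _); apply/seteqP; split => w /= wJ i.
    by move=> /imsetP[k kJ ->]; exact: wJ.
  by move=> iJ; have := wJ (Some i); apply; exact: imset_f.
have Xs_ident k (A : set R) : measurable A ->
    distribution P (Xs k) A = distribution P X A.
  by move=> mA; exact: (hident (Some k) None).
have [dO [Om [mu [t [mt tE]]]]] := triangular_vector R d.+1.
pose tv o : 'rV[R]_d.+1 := \row_i t o i.
have tvE (u : 'rV[R]_d.+1) : \int[mu]_o cos (dot (tv o) u) = tri_char_vec u.
  have [+ _] := tE (fun i => u 0 (inord i)).
  rewrite (_ : \prod_(i < d.+1) _ = tri_char_vec u); last first.
    by apply: eq_bigr => i _; rewrite inord_val.
  move=> <-; apply: eq_Rintegral => o _; congr cos; apply: eq_bigr => i _.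
  by rewrite mxE inord_val.
have mtv i : measurable_fun setT (fun o => tv o 0 i).
  by under eq_fun do rewrite mxE; exact: mt.
(* normalized V, as a probability measure *)
pose W : probability R R := HB.pack_for (probability R R)
  (mscale (((total_mass V)%:num^-1)%:nng : {nonneg R}) V)
  (Measure_isProbability.Build _ _ _
     (mscale (((total_mass V)%:num^-1)%:nng : {nonneg R}) V)
     (normalized_setT hVG hV0)).
(* the characteristic function of H *)
pose h (u : 'rV[R]_d.+1) := expR (- ((total_mass V)%:num / 2 *
        \sum_(k < n) (1 - cos (dot u (a k))))).
pose S w : 'rV[R]_d.+1 := \sum_(k < n) Xs k w *: a k.
have mS i : measurable_fun setT (fun w => S w 0 i).
  under eq_fun do rewrite summxE; apply: measurable_sum => k.
  by under eq_fun do rewrite mxE; exact: measurable_funM.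
have mid i : measurable_fun setT
    (fun y : borel_rV R d.+1 => (y : 'rV[R]_d.+1) 0 i).
  exact: measurable_coord.
have cos1 (x : R) : `|cos x| <= 1 := cos_max x.
have mcos := @measurable_cosine R.
pose g z := \int[H]_y tri_char_vec ((z / tau) *: (y : 'rV[R]_d.+1)).
have h01 u : 0 <= h u <= 1.
  rewrite /h expR_ge0/= -[leRHS]expR0 ler_expR oppr_le0 mulr_ge0 ?divr_ge0//.
  by apply: sumr_ge0 => k _; rewrite subr_ge0 cos_le1.
have h1 u : `|h u| <= 1 by have /andP[? ?] := h01 u; rewrite ger0_norm.
have hE u : h u = \int[H]_y cos (dot u y).
  by have := hH u => /(congr1 (@complex.Re R)).
(* averaging h over the random vector amounts to integrating the kernel
   against H *)
have hg z : \int[mu]_o h ((z / tau) *: tv o) = g z.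
  under eq_Rintegral do rewrite hE.
  rewrite (@Rintegral_Fubini _ _ _ _ _ mu H
    (fun w => cos (dot ((z / tau) *: tv w.1) (w.2 : 'rV[R]_d.+1))) 1)//; last first.
    apply: measurableT_comp => //; under eq_fun do rewrite dotZl.
    apply: measurable_funM => //.
    apply: measurable_dot => i; first exact: (measurableT_comp (mtv i)).
    exact: (measurableT_comp (mid i)).
  apply: eq_Rintegral => y _; rewrite -tvE.
  by apply: eq_Rintegral => o _; rewrite /= dotZl dotZr.
pose f2 (w : R * Om) := h ((w.1 / tau) *: tv w.2).
have mf2 : measurable_fun setT f2.
  apply: measurableT_comp => //; apply: measurableT_comp => //.
  apply: measurable_funM => //; apply: measurable_sum => k.
  apply: measurable_funB => //; apply: measurableT_comp => //.
  under eq_fun do rewrite dotZl; apply: measurable_funM.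
    exact: measurable_funM.
  apply: measurable_dot => i; first exact: (measurableT_comp (mtv i)).
  exact: measurable_cst.
have Wg : W.-integrable setT (EFin \o g).
  apply: eq_integrable (integrable_Rintegral1 W mu mf2 (fun w => h1 _)) => // z _.
  by rewrite /= -hg.
have phi_le x o : \int[P]_w cos (dot (tv o) (tau^-1 *: (S w - x))) <=
    \int[W]_z h ((z / tau) *: tv o).
  pose s k := dot (tv o) (a k) / tau.
  have -> : \int[P]_w cos (dot (tv o) (tau^-1 *: (S w - x))) =
      \int[P]_w cos (\sum_k s k * Xs k w - tau^-1 * dot (tv o) x).
    apply: eq_Rintegral => w _; rewrite dotZr dotBr dot_sumr mulrBr mulr_sumr.
    by congr (cos (_ - _)); apply: eq_bigr => k _; rewrite /s; ring.
  apply: le_trans (Rintegral_cosB_le _ _ _) _.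
    by apply: measurable_sum => k; exact: measurable_funM.
  apply: le_trans (charsq_wsum_le_mixture hVG hV0 s Xs_indep Xs_ident) _.
  rewrite le_eqVlt; apply/orP; left; apply/eqP.
  apply: eq_Rintegral => z _; congr (expR (- (_ * _))).
  by apply: eq_bigr => k _; rewrite dotZl /s; congr (1 - cos _); ring.
(* Fubini moves the random vector outside, where phi_le applies, then back
   inside the integral over z *)
have key x : \int[P]_w tri_char_vec (tau^-1 *: (S w - x)) <= \int[W]_z g z.
  pose f1 (w : T * Om) := cos (dot (tv w.2) (tau^-1 *: (S w.1 - x))).
  have mf1 : measurable_fun setT f1.
    apply: measurableT_comp => //; under eq_fun do rewrite dotZr.
    apply: measurable_funM => //; apply: measurable_dot => i.
      exact: (measurableT_comp (mtv i)).
    under eq_fun do rewrite !mxE; apply: measurable_funB => //.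
    exact: (measurableT_comp (mS i)).
  under eq_Rintegral do rewrite -tvE.
  rewrite (Rintegral_Fubini P mu mf1 (fun w => cos1 _)).
  under [leRHS]eq_Rintegral do rewrite -hg.
  rewrite (Rintegral_Fubini W mu mf2 (fun w => h1 _)).
  apply: le_Rintegral => //.
  - exact: (integrable_Rintegral2 P mu mf1 (fun w => cos1 _)).
  - exact: (integrable_Rintegral2 W mu mf2 (fun w => h1 _)).
  - by move=> o _; exact: phi_le.
apply: ge_ereal_sup => _ [x _ <-].
apply: le_trans (ball_le_tri_char_vec mS P x tau0) _.
apply: (@le_trans _ _ (C1 * \int[W]_z g z)%:E).
  by rewrite lee_fin ler_wpM2l// ltW.
rewrite EFinM [(C1 * C2)%:E]EFinM -muleA lee_wpmul2l ?lee_fin ?(ltW C10)//.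
have g0 z : 0 <= g z by apply: Rintegral_ge0 => y _; exact: tri_char_vec_ge0.
have gQ z : ((g z)%:E <= C2%:E * concentration H (div_norm tau z))%E.
  rewrite EFin_Rintegral; first exact: small_ball_tri_char_vec.
  apply: (@bounded_integrableP _ _ _ _ 1).
    have := measurable_tri_char_vec mid (z / tau) 0.
    by under eq_fun do rewrite subr0.
  by move=> y; rewrite ger0_norm ?tri_char_vec_ge0// tri_char_vec_le1.
rewrite -lee_pdivrMl// EFin_Rintegral// -integralZl//.
apply: le_integral_nneg => z; first by rewrite -EFinM lee_fin mulr_ge0// invr_ge0 ltW.
by rewrite lee_pdivrMl.
Qed.
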